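(* Let $\mathfrak m$ be a nonzero ideal of $A=\mathbb F_q[T]$ and $\mathfrak p=(\wp)$ a nonzero prime ideal with $\wp$ monic and $\mathfrak p$ coprime to $\mathfrak m$. Let $n\ge0$ and $f\in M_{k-2n,m-n}(\Gamma_0(\mathfrak m\mathfrak p))$. Then \[U_{\mathfrak p}(fE^n)=\sum_{h=0}^n\binom nh\wp^h\,U_{\mathfrak p}\big(fE_{\mathfrak p}^{n-h}\big)E^h,\] where $fE^n$ is regarded as a quasi-modular form of weight $k$, type $m$, and $fE_{\mathfrak p}^{n-h}$ as a modular form of weight $k-2h$, type $m-h$.
   Context: Let $K=\mathbb F_q(T)$, $A=\mathbb F_q[T]$, $K_\infty$ the completion at $\infty=1/T$ with norm $|\cdot|_\infty$, $\mathbb C_\infty$ the completion of an algebraic closure of $K_\infty$, $\Omega=\mathbb P^1(\mathbb C_\infty)\setminus\mathbb P^1(K_\infty)$ with Möbius action. For $\gamma=\begin{pmatrix}a&b\\c&d\end{pmatrix}$, $(f|_{k,m}\gamma)(z)=(\det\gamma)^m(cz+d)^{-k}f(\gamma z)$. $\Gamma_0(\mathfrak n)=\{\begin{pmatrix}a&b\\c&d\end{pmatrix}\in\mathrm{GL}_2(A):c\equiv0\bmod\mathfrak n\}$. A rigid analytic $f$ is a quasi-modular function of weight $k\ge0$, type $m$, depth $\ell$ for a subgroup $\Gamma$ if there exist rigid analytic $f_0,\dots,f_\ell$, each invariant under translation by some nonzero ideal of $A$, $f_\ell\ne0$, with $(f|_{k,m}\gamma)(z)=\sum_{i=0}^\ell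 f_i(z)(\frac{c}{cz+d})^i$ for all $z,\gamma\in\Gamma$ ($0$ counts); a quasi-modular form if additionally each $f_i|_{k-2i,m-i}\gamma$ ($\gamma\in\mathrm{GL}_2(K)$) is bounded as $\inf_{x\in K_\infty}|z-x|_\infty\to\infty$; $M_{k,m}(\Gamma)$ is the space of those of depth 0 (Drinfeld modular forms). $E(z)=\tilde\pi^{-1}\sum_{a\text{ monic}}\sum_{b\in A}\frac{a}{az+b}$ is the false Eisenstein series ($\tilde\pi$ a Carlitz period), quasi-modular of weight 2, type 1, depth 1 for $\mathrm{GL}_2(A)$. $E_{\mathfrak p}(z)=E(z)-\wp E(\wp z)$, a modular form of weight 2, type 1 for $\Gamma_0(\mathfrak p)$. For a quasi-modular form $g$ of weight $k'$, type $m'$ for $\Gamma_0(\mathfrak m\mathfrak p)$, $U_{\mathfrak p}(g)=\wp^{k'-m'}\sum_{Q\in A,\ \deg Q<\deg\wp}g|_{k',m'}\begin{pmatrix}1&Q\\0&\wp\end{pmatrix}$. *)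

(* Defs.v *)
From HB Require Import structures.
From mathcomp Require Import all_boot all_order all_algebra.
From mathcomp Require Import finmap.
From mathcomp Require Import classical_sets boolp functions reals topology.
From mathcomp Require Import normedtype sequences.
From mathcomp.analysis.showcase Require Import summability.

Set Implicit Arguments.
Unset Strict Implicit.
Unset Printing Implicit Defensive.

Import Order.TTheory GRing.Theory Num.Theory.

Local Open Scope classical_set_scope.
Local Open Scope ring_scope.

(* The library's normed modules exclude positive characteristic (their norm
   satisfies `|x *+ n| = `|x| *+ n), hence this structure of a field with a
   non-archimedean absolute value; it gets the topology of the metric
   vabs (x - y). *)
HB.mixin Record isValuedField (R : realType) (C : Type) & GRing.Field C := {
  vabs : C -> R ;
  vabs_ge0 : forall x, 0 <= vabs x ;
  vabs_eq0 : forall x, vabs x = 0 <-> x = 0 ;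
  vabsM : forall x y, vabs (x * y) = vabs x * vabs y ;
  vabs_ultra : forall x y, vabs (x + y) <= Num.max (vabs x) (vabs y) }.

#[short(type="valuedFieldType")]
HB.structure Definition ValuedField (R : realType) :=
  {C of GRing.Field C & isValuedField R C}.

Section ValuedFieldMetric.
Context {R : realType} {C : valuedFieldType R}.
Implicit Types x y z : C.

Lemma vabs1 : vabs (1 : C) = 1.
Proof.
have h : vabs (1 : C) != 0.
  by apply/eqP => /vabs_eq0/eqP; rewrite oner_eq0.
by apply: (mulIf h); rewrite -vabsM !mul1r.
Qed.

Lemma vabsN x : vabs (- x) = vabs x.
Proof.
have h : vabs (-1 : C) = 1.
  apply/eqP; rewrite -(@pexpr_eq1 _ _ 2) ?vabs_ge0//.
  by rewrite expr2 -vabsM mulrNN mulr1 vabs1.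
by rewrite -mulN1r vabsM h mul1r.
Qed.

Let d x y := vabs (x - y).

Let dxx x : d x x = 0.
Proof. by rewrite /d subrr; apply/vabs_eq0. Qed.

Let d_eq0 x y : d x y = 0 -> x = y.
Proof. by move/vabs_eq0/eqP; rewrite subr_eq0 => /eqP. Qed.

Let d_sym x y : d x y = d y x.
Proof. by rewrite /d -opprB vabsN. Qed.

Let d_triangle y x z : d x z <= d x y + d y z.
Proof.
rewrite /d -(subrKA y) (le_trans (vabs_ultra _ _))// ge_max.
by rewrite lerDl lerDr !vabs_ge0.
Qed.

HB.instance Definition _ := @isMetric.Build R C d dxx d_eq0 d_sym d_triangle.
HB.instance Definition _ := isPointed.Build C 0.

End ValuedFieldMetric.

Section DrinfeldModularForms.
Context {R : realType} {F : finFieldType} {C : valuedFieldType R}.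
Variable iota : {rmorphism {fraction {poly F}} -> C}.

Definition embA (a : {poly F}) : C := iota (tofrac a).

Definition Kinfty : set C := closure (range iota).

Definition Kinfty_alg : set C :=
  [set x | exists2 p : {poly C}, p != 0 & (forall i, Kinfty p`_i) /\ root p x].

(* Kinfty is closed in the complete field C, hence is the completion of K; the
   last two fields make C the completion of the algebraic closure Kinfty_alg of
   Kinfty. *)
Record is_Cinfty : Prop := IsCinfty {
  vabs_embA : forall a : {poly F}, a != 0 ->
    vabs (embA a) = #|F|%:R ^+ (size a).-1 ;
  Cinfty_complete : forall G : set_system C,
    ProperFilter G -> cauchy G -> cvg G ;
  Kinfty_alg_closed : forall p : {poly C}, (forall i, Kinfty_alg p`_i) ->
    (1 < size p)%N -> exists2 x, Kinfty_alg x & root p x ;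
  Kinfty_alg_dense : dense Kinfty_alg }.

(* Since infinity lies in P^1(Kinfty), Omega is a subset of C. Functions on
   Omega are total functions C -> C whose values off Omega are irrelevant. *)
Definition Omega : set C := ~` Kinfty.

Definition imdist (z : C) : R := inf [set vabs (z - x) | x in Kinfty].

Definition Omega_affinoid (N : nat) : set C :=
  [set z | vabs z <= #|F|%:R ^+ N /\ #|F|%:R ^- N <= imdist z].

(* The Omega_affinoid N form the standard admissible affinoid covering of
   Omega, and the analytic functions on an affinoid subset of P^1 are the
   uniform limits of rational functions without poles there. *)
Definition rigid_analytic (f : C -> C) : Prop :=
  forall (N : nat) (e : R), 0 < e ->
  exists p r : {poly C}, forall z, Omega_affinoid N z ->
    r.[z] != 0 /\ vabs (f z - p.[z] / r.[z]) < e.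

Definition moebius (g : 'M[C]_2) (z : C) : C :=
  (g 0 0 * z + g 0 1) / (g 1 0 * z + g 1 1).

Definition slash (k m : int) (g : 'M[C]_2) (f : C -> C) (z : C) : C :=
  (\det g) ^ m * (g 1 0 * z + g 1 1) ^ (- k) * f (moebius g z).

Definition Gamma0 (n : {poly F}) : set 'M[{poly F}]_2 :=
  [set g | g \in unitmx /\ n %| g 1 0].

(* A nonzero ideal of F[T] is given by a nonzero generator. *)
Definition ideal_periodic (f : C -> C) : Prop :=
  exists2 b : {poly F}, b != 0 &
  forall (a : {poly F}) (z : C), Omega z -> f (z + embA (a * b)) = f z.

Definition bounded_at_infty (f : C -> C) : Prop :=
  exists M B : R, forall z, Omega z -> M <= imdist z -> vabs (f z) <= B.

Definition qm_expansion (k m : int) (l : nat) (Gamma : set 'M[{poly F}]_2)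
    (f : C -> C) (fs : 'I_l.+1 -> C -> C) : Prop :=
  [/\ forall i, rigid_analytic (fs i) /\ ideal_periodic (fs i),
      exists2 z, Omega z & fs ord_max z != 0 &
      forall g z, Gamma g -> Omega z ->
        slash k m (map_mx embA g) f z =
        \sum_(i < l.+1) fs i z *
          (embA (g 1 0) / (embA (g 1 0) * z + embA (g 1 1))) ^+ i].

(* The first disjunct counts the zero function for every weight, type and
   depth, although it admits no expansion with nonzero top coefficient. *)
Definition quasimodular_form (k m : int) (l : nat)
    (Gamma : set 'M[{poly F}]_2) (f : C -> C) : Prop :=
  [/\ 0 <= k, rigid_analytic f &
    (forall z, Omega z -> f z = 0) \/
    exists2 fs : 'I_l.+1 -> C -> C, qm_expansion k m Gamma f fs &
      forall (i : 'I_l.+1) (g : 'M[{fraction {poly F}}]_2), g \in unitmx ->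
        bounded_at_infty
          (slash (k - 2 * i%:Z) (m - i%:Z) (map_mx iota g) (fs i))].

Definition modular_form (k m : int) (Gamma : set 'M[{poly F}]_2) :
  set (C -> C) := [set f | quasimodular_form k m 0 Gamma f].

Definition carlitz_D (i : nat) : {poly F} :=
  \prod_(j < i) ('X^(#|F| ^ i) - 'X^(#|F| ^ j)).

(* The exponential of the Carlitz module T |-> T + tau. *)
Definition carlitz_exp (z : C) : C :=
  limn (series (fun i => z ^+ (#|F| ^ i) / embA (carlitz_D i))).

Definition carlitz_period (pit : C) : Prop :=
  pit != 0 /\
  forall z, carlitz_exp z = 0 <-> exists a : {poly F}, z = pit * embA a.

Definition usum (I : choiceType) (x : I -> C) : C :=
  lim (partial_sum x @ totally).

Definition false_eisenstein (pit z : C) : C :=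
  pit^-1 * usum (fun a : {poly F} =>
    if a \is monic
    then usum (fun b : {poly F} => embA a / (embA a * z + embA b)) else 0).

Definition eisenstein_p (pit : C) (wp : {poly F}) (z : C) : C :=
  false_eisenstein pit z - embA wp * false_eisenstein pit (embA wp * z).

Definition Up_mx (wp Q : {poly F}) : 'M[{poly F}]_2 :=
  \matrix_(i < 2, j < 2)
    if i == 0 then (if j == 0 then 1 else Q) else (if j == 0 then 0 else wp).

(* {poly_n F} is the type of polynomials of size at most n, i.e. degree < n. *)
Definition Up (wp : {poly F}) (k m : int) (g : C -> C) (z : C) : C :=
  embA wp ^ (k - m) *
  \sum_(Q : {poly_((size wp).-1) F}) slash k m (map_mx embA (Up_mx wp Q)) g z.

End DrinfeldModularForms.

(* Main.v *)
(* The matrix (1, Q; 0, wp) acts on Omega by w := (z + Q) / wp, and the weight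
   and type factors of U_p cancel, so U_p g is z |-> sum_Q g ((z + Q) / wp) for
   every weight and type. Since E is invariant under translation by A,
   E_p w = E w - wp * E (z + Q) = E w - wp * E z, and the theorem is the binomial
   expansion of E w ^+ n = (E_p w + wp * E z) ^+ n, summed over Q. *)

Require Import Defs.
From HB Require Import structures.
From mathcomp Require Import all_boot all_order all_algebra.
From mathcomp Require Import finmap.
From mathcomp Require Import boolp classical_sets reals topology.
From mathcomp.analysis.showcase Require Import summability.
From mathcomp Require Import ring.

Set Implicit Arguments.
Unset Strict Implicit.
Unset Printing Implicit Defensive.

Import Order.TTheory GRing.Theory Num.Theory.

Local Open Scope ring_scope.

Lemma partial_sum_comp (I J : choiceType) (V : zmodType) (h : I -> J)
    (x : J -> V) (A : {fset I}) : injective h ->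
  partial_sum (x \o h) A = partial_sum x (h @` A)%fset.
Proof.
move=> h_inj; rewrite /partial_sum -(big_seq_fsetE _ _ predT (x \o h)) /=.
rewrite -(big_seq_fsetE _ _ predT x) /= big_imfset //.
by move=> i j _ _; exact: h_inj.
Qed.

(* Reindexing leaves the filter of partial sums unchanged, so its limit is
   preserved even when the sum does not converge. *)
Lemma usum_reindex (R : realType) (C : valuedFieldType R) (I J : choiceType)
    (h : I -> J) (x : J -> C) : bijective h -> usum (x \o h) = usum x.
Proof.
case=> g hK gK; have h_inj := can_inj hK.
have imK (A : {fset I}) : (g @` (h @` A))%fset = A.
  apply/fsetP => i; apply/imfsetP/idP => /= [[_ /imfsetP[j /= jA ->] ->]|iA].
    by rewrite hK.
  by exists (h i); rewrite ?hK ?in_imfset.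
have imK' (B : {fset J}) : (h @` (g @` B))%fset = B.
  apply/fsetP => i; apply/imfsetP/idP => /= [[_ /imfsetP[j /= jB ->] ->]|iB].
    by rewrite gK.
  by exists (g i); rewrite ?gK // in_imfset.
(* Taking images under [h] and [g] gives inverse order isomorphisms between the finite subsets of
   [I] and [J], so the cones of supersets that generate the two filters correspond. *)
have subh (A : {fset I}) (B : {fset J}) :
    (h @` A `<=` B)%fset = (A `<=` g @` B)%fset.
  apply/idP/idP => [|] AB.
    by rewrite -[A]imK; apply: subset_imfset; apply/fsubsetP.
  by rewrite -[B]imK'; apply: subset_imfset; apply/fsubsetP.
rewrite /usum; congr (lim _); apply/seteqP; split=> P [A _ AP] /=.
  exists (h @` A)%fset => // B /=; rewrite subh => /AP /=.
  by rewrite partial_sum_comp // imK'.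
exists (g @` A)%fset => // B /= AB; rewrite partial_sum_comp //.
by apply: AP => /=; rewrite -[A]imK'; apply: subset_imfset; apply/fsubsetP.
Qed.

Section Hecke.
Context {R : realType} {F : finFieldType} {C : valuedFieldType R}.
Variable iota : {rmorphism {fraction {poly F}} -> C}.

(** For fixed [a], the identity a(z + Q) + b = az + (aQ + b) shows that the translation only
    permutes the inner sum, through b -> aQ + b. *)
Lemma false_eisensteinD (pit z : C) (Q : {poly F}) :
  false_eisenstein iota pit (z + embA iota Q) = false_eisenstein iota pit z.
Proof.
rewrite /false_eisenstein; congr (_ * usum _); apply/funext => a.
case: ifP => // _; rewrite -[RHS](@usum_reindex _ _ _ _ (+%R (a * Q))).
  congr usum; apply/funext => b /=.
  by rewrite /embA !rmorphD !rmorphM /= mulrDr addrA.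
by exists (+%R (- (a * Q))) => b; rewrite ?addKr ?addNKr.
Qed.

Lemma UpE (wp : {poly F}) (k m : int) (g : C -> C) (z : C) : wp != 0 ->
  Up iota wp k m g z =
  \sum_(Q : {poly_((size wp).-1) F}) g ((z + embA iota Q) / embA iota wp).
Proof.
move=> wp0; have ewp0 : embA iota wp != 0 by rewrite fmorph_eq0 tofrac_eq0.
rewrite /Up mulr_sumr; apply: eq_bigr => Q _; rewrite /slash /moebius.
have -> : \det (map_mx (embA iota) (Up_mx wp Q)) = embA iota wp.
  (* [det_trig] expects a lower triangular matrix and [Up_mx] is upper triangular, hence the
     transpose. *)
  rewrite -det_tr det_trig.
    by rewrite !big_ord_recl big_ord0 !mxE /= /embA !rmorph1 mul1r mulr1.
  apply/is_trig_mxP => -[[|[|//]] ?] [[|[|//]] ?] // _.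
  by rewrite !mxE /= /embA !rmorph0.
rewrite !mxE /= /embA !rmorph0 !rmorph1 !mul0r !mul1r add0r.
(* The exponents of [embA iota wp] add up to (k - m) + m - k = 0. *)
by rewrite !mulrA -!expfzDr // subrK subrr expr0z mul1r.
Qed.

End Hecke.

Theorem theorem5p12 (R : realType) (F : finFieldType)
    (C : valuedFieldType R)
    (iota : {rmorphism {fraction {poly F}} -> C}) (hC : is_Cinfty iota)
    (pit : C) (hpit : carlitz_period iota pit)
    (mm wp : {poly F}) (hmm : mm != 0) (hwp_monic : wp \is monic)
    (hwp_irr : irreducible_poly wp) (hcop : coprimep mm wp)
    (n : nat) (k m : int) (f : C -> C)
    (hf : modular_form iota (k - 2 * n%:Z) (m - n%:Z)
            (Gamma0 (mm * wp)) f) :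
  forall z, Omega iota z ->
    Up iota wp k m (fun w => f w * false_eisenstein iota pit w ^+ n) z =
    \sum_(h < n.+1) 'C(n, h)%:R * embA iota wp ^+ h
      * Up iota wp (k - 2 * h%:Z) (m - h%:Z)
          (fun w => f w * eisenstein_p iota pit wp w ^+ (n - h)) z
      * false_eisenstein iota pit z ^+ h.
Proof.
move=> z _; have wp0 : wp != 0 := monic_neq0 hwp_monic.
have ewp0 : embA iota wp != 0 by rewrite fmorph_eq0 tofrac_eq0.
(* The factors around each [Up] on the right do not depend on [Q], so they move inside its sum;
   after exchanging the sums, the identity is checked for each [Q] separately. *)
rewrite UpE // (eq_bigr (fun h : 'I_n.+1 =>
  \sum_(Q : {poly_((size wp).-1) F}) 'C(n, h)%:R * embA iota wp ^+ h *
    (f ((z + embA iota Q) / embA iota wp) *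
     eisenstein_p iota pit wp ((z + embA iota Q) / embA iota wp) ^+ (n - h)) *
    false_eisenstein iota pit z ^+ h)); last first.
  by move=> h _; rewrite UpE // mulr_sumr mulr_suml.
rewrite exchange_big /=; apply: eq_bigr => Q _.
set w := _ / _.
have -> : false_eisenstein iota pit w =
    eisenstein_p iota pit wp w + embA iota wp * false_eisenstein iota pit z.
  by rewrite /eisenstein_p [embA iota wp * w]mulrC /w divfK //
    false_eisensteinD subrK.
(* [exprDn] gives the exponent [n - h] to the first summand, so [h] counts the factors wp * E z, as
   in the statement. *)
rewrite exprDn mulr_sumr; apply: eq_bigr => h _.
by rewrite exprMn -mulr_natl; ring.
Qed.
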